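(* Let $H_n(t)=F_{2n+1}(t)$, where $F_q(t)=\det(I-M(t)^q)$. Then the sequence $(H_n(t))_{n\ge 0}$ satisfies a homogeneous linear recurrence of order at most $8$ with coefficients independent of $n$; that is, there are an integer $d\le 8$ and $c_0(t),\dots,c_d(t)\in\mathbb{Z}[t,t^{-1}]$ with $c_d(t)\ne 0$ such that $\sum_{j=0}^d c_j(t)H_{n+j}(t)=0$ for all $n\ge 0$.
   Context: $M(t)=\begin{pmatrix}1-t&1-t^{-1}&-1\\1&1-t^{-1}&-1\\0&t&-t\end{pmatrix}$, a matrix over $\mathbb{Z}[t,t^{-1}]$ (the image of $\sigma_1\sigma_2^{-1}\sigma_3\in B_4$ under the reduced Burau representation). *)

(* Defs.v *)
From HB Require Import structures.
From mathcomp Require Import all_boot all_order all_algebra.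
From mathcomp Require Import boolp.
Set Implicit Arguments.
Unset Strict Implicit.
Unset Printing Implicit Defensive.
Import GRing.Theory.
Local Open Scope ring_scope.

Local Notation "x %:F" := (FracField.tofrac x).

(* The ring Z[t, t^-1] is realized as the subring of Q(t), the fraction field
   of Z[t], made of the fractions p / t^k with p in Z[t]. *)

Definition is_laurent : {pred {fraction {poly int}}} :=
  fun x => `[< exists (p : {poly int}) (k : nat), x = p%:F / ('X%:F) ^+ k >].

Lemma is_laurentP (x : {fraction {poly int}}) :
  reflect (exists (p : {poly int}) (k : nat), x = p%:F / ('X%:F) ^+ k)
          (x \in is_laurent).
Proof. exact: asboolP. Qed.

Lemma tofracX_neq0 : ('X : {poly int})%:F != 0.
Proof. by rewrite tofrac_eq0 polyX_eq0. Qed.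

Fact is_laurent_subring_closed : subring_closed is_laurent.
Proof.
have X0 k : ('X : {poly int})%:F ^+ k != 0 by rewrite expf_neq0 ?tofracX_neq0.
split.
- by apply/is_laurentP; exists 1, 0%N; rewrite expr0 divr1 tofrac1.
- move=> x y /is_laurentP[p [k ->]] /is_laurentP[q [l ->]].
  apply/is_laurentP; exists (p * 'X^l - q * 'X^k), (k + l)%N.
  by rewrite tofracB !tofracM !tofracXn exprD -mulNr addf_div ?X0 // mulNr.
- move=> x y /is_laurentP[p [k ->]] /is_laurentP[q [l ->]].
  apply/is_laurentP; exists (p * q), (k + l)%N.
  by rewrite tofracM exprD mulf_div.
Qed.

HB.instance Definition _ := GRing.isSubringClosed.Build
  {fraction {poly int}} is_laurent is_laurent_subring_closed.

Record laurent := Laurent {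
  laurent_val :> {fraction {poly int}};
  _ : laurent_val \in is_laurent }.

HB.instance Definition _ := [isSub for laurent_val].
HB.instance Definition _ := [Choice of laurent by <:].
HB.instance Definition _ := [SubChoice_isSubComNzRing of laurent by <:].

Fact tvar_subproof : ('X : {poly int})%:F \in is_laurent.
Proof. by apply/is_laurentP; exists 'X, 0%N; rewrite expr0 divr1. Qed.

Fact tinv_subproof : (('X : {poly int})%:F)^-1 \in is_laurent.
Proof. by apply/is_laurentP; exists 1, 1%N; rewrite tofrac1 expr1 div1r. Qed.

Definition tvar : laurent := Laurent tvar_subproof.
Definition tinv : laurent := Laurent tinv_subproof.

Lemma tvarK : tvar * tinv = 1.
Proof. by apply: val_inj; rewrite /= divff ?tofracX_neq0. Qed.

Definition M : 'M[laurent]_3 :=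
  \matrix_(i < 3, j < 3)
    nth 0 (nth [::]
      [:: [:: 1 - tvar; 1 - tinv; - 1];
          [:: 1;        1 - tinv; - 1];
          [:: 0;        tvar;     - tvar]] i) j.

Definition F (q : nat) : laurent := \det (1%:M - M ^+ q).

Definition H (n : nat) : laurent := F (2 * n + 1).

(* Main.v *)
Require Import Defs.
From mathcomp Require Import all_boot all_order all_algebra ring.
Local Open Scope ring_scope.
Import GRing.Theory.

(** Over any commutative ring, the sequence det (1 - A^(2n+1)) of a 3 x 3 matrix
    [A] satisfies a monic recurrence of order 8; the theorem is the case of [M].
    If [A] has eigenvalues a, b, c, then

      (1 - a^q) (1 - b^q) (1 - c^q) = sum over S of (-1)^|S| (prod S)^q,

    where S runs over the eight subsets of {a, b, c}.  For q = 2n+1 each term is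
    geometric in n with ratio (prod S)^2, so the polynomial with the eight roots
    (prod S)^2 gives the coefficients of the recurrence.

    Eigenvalues are avoided by grouping the subsets by cardinality, that is by
    exterior powers of [A]: for sizes 0, 1, 2, 3 the contributions are 1,
    tr A^q, tr (adj A)^q and (det A)^q ([det_sub1mx3] with [adj_expmx]), the
    adjugate playing the part of the second exterior power, with eigenvalues
    bc, ca, ab.  The polynomial [odd_power_poly] is the product of the
    characteristic polynomials of the squares of these four operators; by
    Cayley-Hamilton it annihilates each of them, hence each of the four
    sequences ([sum_coef_mxtrace], [sum_coef_expr]).  Being monic of degree 8,
    it has leading coefficient 1, which is nonzero. *)

(** Multiplying both sides by A B turns the identity into an equality of scalar
    matrices, so it holds once det (A B) can be cancelled.  Replacing [A] and
    [B] by X + A and X + B makes this determinant monic, hence regular; the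
    result for [A] and [B] follows by setting X = 0. *)
Lemma adj_mulmx (R : comNzRingType) (n : nat) (A B : 'M[R]_n) :
  \adj (A *m B) = \adj B *m \adj A.
Proof.
(* A' = X + A and B' = X + B *)
pose A' := char_poly_mx (- A); pose B' := char_poly_mx (- B).
have lregAB : GRing.lreg (\det (A' *m B')).
  by apply: monic_lreg; rewrite det_mulmx monicMr ?char_poly_monic.
have adjAB : \adj (A' *m B') = \adj B' *m \adj A'.
  have eqAB : \adj (A' *m B') *m (A' *m B') = \adj B' *m \adj A' *m (A' *m B').
    rewrite mul_adj_mx mulmxA -(mulmxA (\adj B')) mul_adj_mx mul_mx_scalar.
    by rewrite -scalemxAl mul_adj_mx scale_scalar_mx det_mulmx.
  have := congr1 (mulmx^~ (\adj (A' *m B'))) eqAB.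
  rewrite -!(mulmxA _ (A' *m B')) mul_mx_adj !mul_mx_scalar => /matrixP eqdet.
  by apply/matrixP => i j; apply: lregAB; have := eqdet i j; rewrite !mxE.
have ev0 (C : 'M[R]_n) : map_mx (horner_eval 0) (char_poly_mx (- C)) = C.
  apply/matrixP => i j.
  by rewrite !mxE /= /horner_eval !(hornerE, hornerMn) mul0rn sub0r opprK.
have := congr1 (map_mx (horner_eval (0 : R))) adjAB.
by rewrite map_mx_adj !map_mxM !map_mx_adj !ev0.
Qed.

Lemma adj_expmx (R : comNzRingType) (n : nat) (A : 'M[R]_n.+1) (q : nat) :
  \adj (A ^+ q) = (\adj A) ^+ q.
Proof.
elim: q => [|q IHq]; first by rewrite !expr0 adj1.
by rewrite exprS exprSr -!mulmxE adj_mulmx IHq.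
Qed.

Lemma det_mx22 (R : comNzRingType) (A : 'M[R]_2) :
  \det A = A ord0 ord0 * A ord_max ord_max - A ord0 ord_max * A ord_max ord0.
Proof.
have max2 : lift ord0 0 = ord_max :> 'I_2 by apply: val_inj.
have min2 : lift ord_max 0 = ord0 :> 'I_2 by apply: val_inj.
rewrite (expand_det_row _ ord0) !big_ord_recl big_ord0 /cofactor !det_mx11 !mxE.
rewrite !max2 !min2 /=; ring.
Qed.

(** This is the value at 1 of the characteristic polynomial, the trace of the
    adjugate being the sum of the principal 2 x 2 minors. *)
Lemma det_sub1mx3 (R : comNzRingType) (A : 'M[R]_3) :
  \det (1%:M - A) = 1 - \tr A + \tr (\adj A) - \det A.
Proof.
(* Indexing the entries by naturals lets the row and column deletions of the
   cofactor expansions compute. *)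
pose a (i j : nat) := A (inord i) (inord j).
have -> : A = \matrix_(i, j) a i j.
  by apply/matrixP => i j; rewrite mxE /a !inord_val.
rewrite /mxtrace !big_ord_recl big_ord0 !mxE /cofactor.
rewrite !det_mx22 !(expand_det_row _ ord0) !big_ord_recl !big_ord0 /cofactor.
rewrite !det_mx22 !mxE /= /bump /= ?(add0n, addn0, addn1); ring.
Qed.

(** By linearity the sum is the trace of A B^n P(B).  The number [d] of terms is
    left free so that the same length serves every sequence. *)
Lemma sum_coef_mxtrace (R : comNzRingType) (m : nat) (A B : 'M[R]_m.+1)
    (P : {poly R}) (d n : nat) :
    (size P <= d)%N -> horner_mx B P = 0 ->
  \sum_(j < d) P`_j * \tr (A *m B ^+ (n + j)) = 0.
Proof.
move=> szP PB0.
have Pdef : P = \poly_(j < d) P`_j.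
  apply/polyP => j; rewrite coef_poly; case: ltnP => // led.
  by rewrite nth_default // (leq_trans szP).
transitivity (\tr (A *m B ^+ n *m horner_mx B P)); last first.
  by rewrite PB0 mulmx0 mxtrace0.
rewrite {2}Pdef poly_def rmorph_sum mulmx_sumr linear_sum /=; apply: eq_bigr => j _.
rewrite linearZ /= rmorphXn /= horner_mx_X -scalemxAr mxtraceZ.
by rewrite exprD -[RHS]/(_ * _) -mulmxE mulmxA.
Qed.

Lemma sum_coef_expr (R : comNzRingType) (a b : R) (P : {poly R}) (d n : nat) :
  (size P <= d)%N -> root P b -> \sum_(j < d) P`_j * (a * b ^+ (n + j)) = 0.
Proof.
move=> szP /rootP Pb0.
transitivity (a * b ^+ n * P.[b]); last by rewrite Pb0 mulr0.
rewrite (horner_coef_wide b szP) mulr_sumr; apply: eq_bigr => j _.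
by rewrite exprD; ring.
Qed.

(** The factors are the characteristic polynomials of the squares of A on its
    exterior powers 0, 1, 2 and 3: if A has eigenvalues a, b, c, the roots are
    the squares of the products of the eight subsets of {a, b, c}. *)
Definition odd_power_poly {R : comNzRingType} (A : 'M[R]_3) : {poly R} :=
  ('X - 1%:P) * char_poly (A ^+ 2) * char_poly ((\adj A) ^+ 2)
  * ('X - (\det A ^+ 2)%:P).

Lemma odd_power_poly_monic (R : comNzRingType) (A : 'M[R]_3) :
  odd_power_poly A \is monic.
Proof. by rewrite !monicMr ?monicXsubC ?char_poly_monic. Qed.

Lemma size_odd_power_poly (R : comNzRingType) (A : 'M[R]_3) :
  size (odd_power_poly A) = 9.
Proof.
by rewrite !size_Mmonic ?monic_neq0 ?monicMr ?monicXsubC ?char_poly_monic //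
     !size_XsubC !size_char_poly.
Qed.

Lemma odd_power_poly_recurrence (R : comNzRingType) (A : 'M[R]_3) (n : nat) :
  \sum_(j < 9) (odd_power_poly A)`_j
    * \det (1%:M - A ^+ (2 * (n + j) + 1)) = 0.
Proof.
set P := odd_power_poly A.
have szP : (size P <= 9)%N by rewrite size_odd_power_poly.
have rP1 : root P 1 by rewrite /P /odd_power_poly /root !hornerE subrr !mul0r.
have rPdet : root P (\det A ^+ 2).
  by rewrite /P /odd_power_poly /root !hornerE subrr !mulr0.
have PA0 : horner_mx (A ^+ 2) P = 0.
  by rewrite /P /odd_power_poly !rmorphM /= Cayley_Hamilton mulr0 !mul0r.
have Padj0 : horner_mx ((\adj A) ^+ 2) P = 0.
  by rewrite /P /odd_power_poly !rmorphM /= Cayley_Hamilton mulr0 mul0r.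
have odd_expr (S : nzRingType) (x : S) m : x ^+ (2 * m + 1) = x * (x ^+ 2) ^+ m.
  by rewrite addn1 exprS exprM.
have det_expr q : \det (A ^+ q) = \det A ^+ q.
  by elim: q => [|q IHq]; rewrite ?det1 // !exprS det_mulmx IHq.
(* The four sums are the parts of the sequence of degree 0, 1, 2 and 3 in the
   eigenvalues of A. *)
transitivity (\sum_(j < 9) P`_j * (1 * 1 ^+ (n + j))
  - \sum_(j < 9) P`_j * \tr (A *m (A ^+ 2) ^+ (n + j))
  + \sum_(j < 9) P`_j * \tr (\adj A *m ((\adj A) ^+ 2) ^+ (n + j))
  - \sum_(j < 9) P`_j * (\det A * (\det A ^+ 2) ^+ (n + j))).
  rewrite -!sumrB -big_split -sumrB /=; apply: eq_bigr => j _.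
  rewrite det_sub1mx3 adj_expmx det_expr !odd_expr !mulmxE expr1n; ring.
by rewrite !sum_coef_mxtrace // !sum_coef_expr // !subr0 addr0.
Qed.

Theorem lemma2p4 :
  exists (d : nat) (c : 'I_d.+1 -> laurent),
    [/\ (d <= 8)%N,
        c ord_max != 0
      & forall n : nat, \sum_(j < d.+1) c j * H (n + j)%N = 0].
Proof.
exists 8, (fun j => (odd_power_poly M)`_j); split => //.
  have /monicP := odd_power_poly_monic _ M.
  by rewrite lead_coefE size_odd_power_poly => ->; apply: oner_neq0.
exact: odd_power_poly_recurrence.
Qed.
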